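(* Let $p\in[1,\infty]$ and let $f$ be a (locally integrable) function of positive type on the hypergroup $H$. Then $$\|f\|^*_{p,\infty}=\|f\|_{p,\infty,U_0}=\|f\mathbf 1_{U_0}\|_p .$$ Moreover, for every relatively compact neighbourhood $U$ of the identity $\infty$ of $H$ there are constants $C_U$ and $C_U'$, independent of $p\in[1,\infty]$, such that $$\|f\|_{p,\infty,U}\le C_U\|f\mathbf 1_U\|_p\qquad\text{and}\qquad \|f\|^*_{p,\infty}\le C_U'\|f\mathbf 1_U\|_p$$ for all (locally integrable) functions $f$ of positive type on $H$. (All quantities are allowed to be $+\infty$.)
   Context: $H=\mathbb Z\cup\{\infty\}$ with the topology in which each point of $\mathbb Z$ is isolated and the sets $U_N=\{N,N+1,N+2,\dots\}\cup\{\infty\}$, $N\in\mathbb Z$, form a neighbourhood base at $\infty$ consisting of compact open sets. $H$ is a locally compact commutative hypergroup with identity $\infty$, identity involution, and convolution of unit point masses $$\varepsilon_n*\varepsilon_n=\sum_{k=1}^\infty 2^{-k}\varepsilon_{n+k}\ (n\in\mathbb Z),\qquad \varepsilon_\infty*\varepsilon_\infty=\varepsilon_\infty,\qquad \varepsilon_m*\varepsilon_n=\varepsilon_{\min\{m,n\}}\ (m\ne n).$$ Its Haar measure is $\omega(\{n\})=2^{-(n+1)}$ for $n\in\mathbb Z$, $\omega(\{\infty\})=0$; $L^p$ norms are with respect to $\omega$. Write $f(m*n)=\int f\,d(\varepsilon_m*\varepsilon_n)$, $\tau_mf(n)=f(m*n)$, and $(f*g)(m)=\int f(m*n)g(n)\,d\omega(n)$.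 A locally integrable function $f:H\to\mathbb C$ is of positive type if $\int f\cdot(g*\overline g)\,d\omega\ge0$ for every $g\in C_c(H)$. Amalgam norms: for a relatively compact neighbourhood $U$ of $\infty$ and $1\le p<\infty$, $\|f\|_{p,\infty,U}=\sup_{x\in H}\|f\,(\tau_x\mathbf 1_U)^{1/p}\|_p$; for $p=\infty$, $\|f\|_{\infty,\infty,U}=\sup_{x\in H}\|f\mathbf 1_{U_x}\|_\infty$ with $U_x=\{y:\tau_x\mathbf 1_U(y)>0\}$. Also, for $1\le p\le\infty$, $$\|f\|^*_{p,\infty}=\max\Big\{\sup_{n<0}|f(n)|,\ \|f\mathbf 1_{U_0}\|_p\Big\}.$$ *)

(* Defs.v *)
From HB Require Import structures.
From mathcomp Require Import all_boot all_order all_algebra.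
From mathcomp Require Import complex.
From mathcomp Require Import all_classical all_reals all_analysis.

Set Implicit Arguments.
Unset Strict Implicit.
Unset Printing Implicit Defensive.

Import Order.TTheory GRing.Theory Num.Theory.
Import numFieldNormedType.Exports.
Import ComplexField.Normc.

Local Open Scope classical_set_scope.
Local Open Scope ring_scope.

(* [Some n] is the integer n and [None] is the point at infinity. *)
Definition H : Type := option int.

HB.instance Definition _ := Choice.on H.
HB.instance Definition _ := isPointed.Build H None.

Definition tailH (N : int) : set H :=
  [set x | if x is Some n then N <= n else True].

Definition nbhsH (x : H) : set_system H :=
  if x is Some _ then principal_filter x else filter_from setT tailH.

HB.instance Definition _ := hasNbhs.Build H nbhsH.

Lemma nbhsH_filter (x : H) : ProperFilter (nbhsH x).
Proof.
case: x => [n|]; first exact: principal_filter_proper.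
apply: filter_from_proper; last by move=> N _; exists None.
apply: filter_from_filter; first by exists 0.
move=> M N _ _; exists (Num.max M N) => //.
by case=> [n|] //=; rewrite ge_max => /andP[].
Qed.

Lemma nbhsH_singleton (x : H) (A : set H) : nbhsH x A -> A x.
Proof. by case: x => [n|[N _]]; [move/principal_filterP|apply]. Qed.

Lemma nbhsH_nbhsH (x : H) (A : set H) : nbhsH x A -> nbhsH x (nbhsH^~ A).
Proof.
case: x => [n|[N _ NA]].
  by move=> /principal_filterP An; apply/principal_filterP/principal_filterP.
exists N => // -[m Nm|_]; last by exists N.
exact/principal_filterP/NA.
Qed.

HB.instance Definition _ := Nbhs_isNbhsTopological.Build H
  nbhsH_filter nbhsH_singleton nbhsH_nbhsH.

(* H is countable with closed points, so every subset is Borel; see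
   [borelH] below. *)
HB.instance Definition _ := @isMeasurable.Build default_measure_display H
  discrete_measurable discrete_measurable0
  discrete_measurableC discrete_measurableU.

Lemma borelH : <<s @open H >> = @measurable _ H.
Proof.
apply/seteqP; split=> // A _.
have bopen (B : set H) : open B -> <<s @open H >> B by exact: sub_sigma_algebra.
have bN (n : int) : <<s @open H >> [set Some n].
  by apply: bopen; rewrite openE => x ->; exact/principal_filterP.
have b0 : <<s @open H >> [set None].
  rewrite (_ : [set None] = setT `\` [set~ None]); last first.
    by rewrite setTD setCK.
  apply: sigma_algebraCD; apply: bopen; rewrite openE => -[n _|/(_ erefl)//].
  exact/principal_filterP.
have -> : A = \bigcup_k (if unpickle k is Some x then A `&` [set (x : H)]
                         else set0).
  apply/seteqP; split=> [x Ax|x [k _]].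
    exists (@pickle (option int) x); first exact: Logic.I.
    by rewrite pickleK; split.
  by case: (unpickle k) => // y [].
apply: sigma_algebra_bigcup => k; move: (ohead _) => x.
have [Ax|nAx] := pselect (A x); last first.
  rewrite (_ : _ `&` _ = set0); first exact: sigma_algebra0.
  by apply/seteqP; split => // y [Ay yx]; apply: nAx; rewrite -yx.
rewrite setIidr; last by move=> _ ->.
by case: x {Ax}.
Qed.

Definition minH (x y : H) : H :=
  match x, y with
  | Some m, Some n => Some (Num.min m n)
  | Some m, None => Some m
  | None, _ => y
  end.

Section Hypergroup.
Variable R : realType.
Local Notation C := R[i].

Definition pow2 (n : int) : {nonneg R} := NngNum (exprz_ge0 n (ler0n R 2)).

Local Notation meas := {measure set H -> \bar R}.

(* The convolution of the unit point masses at x and y. *)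
Definition conv_mass (x y : H) : meas :=
  if x == y then
    if x is Some n then
      (mseries (fun k => mscale (pow2 (- k%:Z)) \d_(Some (n + k%:Z) : H)) 1
        : meas)
    else (\d_(None : H) : meas)
  else (\d_(minH x y) : meas).

(* The sum over the integers n of 2 ^ - (n + 1) times the unit point mass at n,
   split into n = k >= 0 and n = - (k + 1) < 0. *)
Definition haar : meas :=
  measure_add
    (mseries (fun k => mscale (pow2 (- (k%:Z + 1))) \d_(Some k%:Z : H)) 0)
    (mseries (fun k => mscale (pow2 k%:Z) \d_(Some (- (k%:Z + 1)) : H)) 0).

Definition Cintegral (mu : meas) (f : H -> C) : C :=
  Complex (\int[mu]_x complex.Re (f x)) (\int[mu]_x complex.Im (f x)).

Definition transl (x : H) (f : H -> C) (y : H) : C := Cintegral (conv_mass x y) f.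

(* The variant of [transl] for real-valued functions. *)
Definition translR (x : H) (f : H -> R) (y : H) : R := \int[conv_mass x y]_z f z.

Definition convol (f g : H -> C) (x : H) : C :=
  Cintegral haar (fun y => transl x f y * g y).

Definition Cc (g : H -> C) : Prop :=
  continuous (g : H -> (C : numFieldType)) /\
  compact (closure [set x | g x != 0]).

(* Measurability is automatic as every subset of H is measurable. *)
Definition loc_integrable (f : H -> C) : Prop :=
  forall K : set H, compact K ->
    (\int[haar]_(x in K) (normc (f x))%:E < +oo)%E.

(* The order of R[i] makes [0 <= z] say that z is real and nonnegative. *)
Definition positive_type (f : H -> C) : Prop :=
  loc_integrable f /\
  forall g : H -> C, Cc g ->
    0 <= Cintegral haar (fun x => f x * convol g (fun y => conjc (g y)) x).

Definition LpH (p : \bar R) (f : H -> C) : \bar R :=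
  'N[haar]_p[EFin \o @normc R \o f]%E.

Definition mul_indic (f : H -> C) (U : set H) (x : H) : C :=
  f x * real_complex R (\1_U x).

(* The second branch is meant for p = +oo; the value at -oo is not used. *)
Definition amalgam (p : \bar R) (U : set H) (f : H -> C) : \bar R :=
  if p is q%:E then
    ereal_sup [set LpH p (fun y =>
      f y * real_complex R (translR x \1_U y `^ q^-1)) | x in [set: H]]
  else
    ereal_sup [set LpH +oo (mul_indic f [set y | 0 < translR x \1_U y])
              | x in [set: H]].

Definition star_norm (p : \bar R) (f : H -> C) : \bar R :=
  maxe (ereal_sup [set (normc (f (Some n)))%:E
                  | n in [set n : int | n < 0]])
       (LpH p (mul_indic f (tailH 0))).

End Hypergroup.

(* Main.v *)
Require Import Defs.
From mathcomp Require Import all_boot all_order all_algebra.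
From mathcomp Require Import finmap complex ring lra zify.
From mathcomp Require Import all_classical all_reals all_analysis.
From mathcomp Require Import measurable_realfun ess_sup_inf.
Set Implicit Arguments.
Unset Strict Implicit.
Unset Printing Implicit Defensive.
Import Order.TTheory GRing.Theory Num.Theory.
Import numFieldNormedType.Exports.
Import ComplexField.Normc.
Local Open Scope classical_set_scope.
Local Open Scope ring_scope.

(** Write U_N for the tail {N, N+1, ..., oo}, of Haar measure 2^-N.

    The indicator of U_N and the function chi_N equal to 1 on U_N, to -1 at
    N - 1 and to 0 below are convolution idempotents up to a positive factor:
    g * g is a multiple of g, as follows from the identity
    g(x * y) g(y) = g(x) g(y)^2 ([translR_charH] and the computation
    in [tail_int_pos]).  Testing a function f of positive type against them
    ([positive_type_test]) shows that F(N), the integral of f over U_N, is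
    real and satisfies 0 <= F(N) and F(N - 1) <= 2 F(N), since
    chi_N = 2 1_(U_N) - 1_(U_(N - 1)).  Now f(n) 2^-(n+1) = F(n) - F(n + 1),
    so the two inequalities bound f(n) from below and from above by the mean
    2^(n+1) F(n + 1) of f over U_(n + 1).  The second one also says that the
    means 2^N F(N) are nondecreasing in N, hence |f(n)| <= 2^N F(N) for all n < N
    ([positive_type_le]): below N, a function of positive type is bounded
    by its mean over U_N.

    Since tau_x 1_(U_M) is 1_(U_M) when x lies in U_M and is
    2^(n - M + 1) 1_{n} when x = n < M, the amalgam norm over U_M is the
    maximum of the L^p norm of f on U_M and of the numbers 2^(-M/p) |f(n)|
    with n < M ([amalgam_tail]).  For M = 0 this is the star norm, and
    |f(n)| <= F(0) <= ||f 1_(U_0)||_1 <= ||f 1_(U_0)||_p for n < 0, because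
    U_0 has measure 1; this is the first assertion.

    A relatively compact neighbourhood U of oo satisfies
    U_N <= U <= U_M for some M <= 0 <= N.  On U_M minus U_N the function f is
    bounded by 2^N F(N) <= 2^N ||f 1_(U_N)||_p, so Minkowski's inequality
    bounds the amalgam norm over U_M by (1 + 2^(N-M)) ||f 1_(U_N)||_p
    ([amalgam_tail_le]).  Both norms in the second assertion are at most the
    former, and the latter is at most ||f 1_U||_p. *)

(** * Topology of H *)

Lemma tailH_le (M N : int) : M <= N -> tailH N `<=` tailH M.
Proof. by move=> MN [n|] //=; exact: le_trans. Qed.

Lemma open_tailH (N : int) : open (tailH N).
Proof.
rewrite openE => -[n|] Nn; first exact/principal_filterP.
by exists N.
Qed.

Lemma closed_tailH (N : int) : closed (tailH N).
Proof.
rewrite -[tailH N]setCK; apply: open_closedC; rewrite openE => -[n|] //= Nn.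
exact/principal_filterP.
Qed.

(** A filter on U_M that does not cluster at oo contains a set missing some
    U_N, hence also the finite set of the integers in [M, N). *)
Lemma compact_tailH (M : int) : compact (tailH M).
Proof.
move=> F PF FM.
have [Fcl|/existsNP[A /existsNP[B]]] := pselect (cluster F (None : H)).
  by exists None.
rewrite !not_implyE => -[FA] [[N _ NB]] AB0.
pose K : set H := (fun k : nat => Some (M + k%:Z)) @` `I_`|N - M|.
have KM : K `<=` tailH M by move=> _ [k _ <-] /=; rewrite lerDl.
have FK : F K.
  apply: filterS (filterI FA FM) => -[n|] [An /= Mn]; last first.
    by case: AB0; exists None; split => //; exact: NB.
  have nN : n < N.
    rewrite ltNge; apply/negP => Nn; case: AB0; exists (Some n).
    by split => //; exact: NB.
  by exists `|n - M|%N => /=; [lia | congr Some; lia].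
have [x [Kx clx]] := @finite_compact _ K (finite_image _ (finite_II _)) F PF FK.
by exists x; split => //; exact: KM.
Qed.

(** The tails form an open cover of H that is totally ordered by inclusion. *)
Lemma compact_sub_tailH (K : set H) : compact K -> exists M, K `<=` tailH M.
Proof.
rewrite compact_cover => /(_ int setT tailH (fun i _ => @open_tailH i)) [].
  by move=> [n|] _; [exists n | exists 0] => //=.
move=> D _ KD.
have [M DM] : exists M : int, forall i, i \in D -> M <= i.
  exists (- (\sum_(i <- D) `|i|)) => i iD.
  rewrite lerNl; apply: le_trans (ler_norm _) _; rewrite normrN.
  by rewrite (big_rem i) //= lerDl sumr_ge0.
by exists M => x /KD[i /= /DM Mi]; apply: (tailH_le Mi).
Qed.

Lemma continuous_eventually_cst (T : topologicalType) (g : H -> T) (N : int) :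
  (forall x, tailH N x -> g x = g None) -> continuous g.
Proof.
move=> gN [n|] A.
  by move=> /nbhs_singleton Ag; exact/principal_filterP.
by move=> /nbhs_singleton Ag; exists N => // x /gN; rewrite /preimage /= => ->.
Qed.

(** * L^p norms and p-th roots *)

Section Root.
Variable R : realType.

(** The operation that the amalgam norms apply to tau_x 1_U: the p-th root for
    finite p and, for p = oo, its limit, the indicator of the positive reals.
    The L^p norm of the indicator of a set A of finite measure is then
    [rootp p] of that measure, so finite and infinite p need not be distinguished. *)
Definition rootp (p : \bar R) (a : R) : R :=
  if p is q%:E then a `^ q^-1 else (0 < a)%R%:R.

Variable p : \bar R.
Hypothesis p1 : (1 <= p)%E.

Lemma rootp1 : rootp p 1 = 1.
Proof. by rewrite /rootp; case: p => [q||]; rewrite ?powR1 ?ltr01. Qed.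

Lemma rootp0 : rootp p 0 = 0.
Proof.
move: p1; rewrite /rootp; case: p => [q||] //; rewrite ?ltxx // lee_fin => q1.
by rewrite powR0 // invr_eq0 gt_eqF // (lt_le_trans ltr01).
Qed.

Lemma rootp_ge0 (a : R) : 0 <= rootp p a.
Proof. by rewrite /rootp; case: p => [q||]; rewrite ?powR_ge0. Qed.

Lemma rootpM (a b : R) : 0 <= a -> 0 <= b ->
  rootp p (a * b) = rootp p a * rootp p b.
Proof.
move=> a0 b0; move: p1; rewrite /rootp.
case: p => [q||] // _; first exact: powRM.
by rewrite lt0r !mulf_eq0 mulr_ge0 // andbT !lt0r a0 b0 !andbT negb_or
  -natrM mulnb.
Qed.

Lemma le_rootp (a b : R) : 0 <= a -> a <= b -> rootp p a <= rootp p b.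
Proof.
move: p1; rewrite /rootp; case: p => [q||] //; last first.
  by move=> _ _ ab; rewrite ler_nat; have [/lt_le_trans ->|] := ltP 0 a.
rewrite lee_fin => q1 a0 ab; apply: ge0_ler_powR; rewrite ?nnegrE //.
  by rewrite invr_ge0 (le_trans ler01).
exact: le_trans ab.
Qed.

Lemma rootp_le (a : R) : 1 <= a -> rootp p a <= a.
Proof.
move: p1; rewrite /rootp; case: p => [q||] //; last first.
  by move=> _ a1; rewrite (lt_le_trans ltr01).
rewrite lee_fin => q1 a1; rewrite -[leRHS]powRr1; last exact: le_trans a1.
apply: ler_powR => //; rewrite invf_le1 // (lt_le_trans ltr01) //.
Qed.
End Root.

Section Lnorm.
Context d (T : measurableType d) (R : realType).
Variable mu : {measure set T -> \bar R}.
Implicit Types (f g : T -> R) (A : set T) (p : \bar R).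
Local Open Scope ereal_scope.

Lemma le_Lnorm p f g : measurable_fun setT f -> measurable_fun setT g ->
  1 <= p -> (forall x, `|f x| <= `|g x|)%R ->
  'N[mu]_p[EFin \o f] <= 'N[mu]_p[EFin \o g].
Proof.
move=> mf mg p1 fg; rewrite unlock; case: p p1 => [q q1|_|//].
  have q0 : (0 <= q)%R by move: q1; rewrite lee_fin; apply: le_trans.
  apply: gt0_ler_poweR; rewrite ?invr_ge0 // ?in_itv /=.
  - by rewrite leey andbT; apply: integral_ge0 => x _; rewrite lee_fin powR_ge0.
  - by rewrite leey andbT; apply: integral_ge0 => x _; rewrite lee_fin powR_ge0.
  have mE (h : T -> R) : measurable_fun setT h ->
      measurable_fun setT ((fun x => `|h x| `^ q)%R : T -> R).
    by move=> mh; apply: (measurableT_comp (measurable_powR q));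
      exact: measurableT_comp.
  apply: ge0_le_integral => //; try exact/measurable_EFinP/mE;
    move=> x _; rewrite lee_fin ?powR_ge0 //.
  by apply: ge0_ler_powR; rewrite ?nnegrE ?fg.
case: ifP => // _; apply: le_ess_sup; apply: nearW => x /=.
by rewrite lee_fin.
Qed.

(** For p = oo the positivity of the measure of A makes the essential supremum
    see the value c. *)
Lemma Lnorm_cst_indic p A (c : R) : measurable A -> 1 <= p ->
  0 < mu A -> mu A < +oo ->
  'N[mu]_p[EFin \o (fun x => c * \1_A x)%R] = (`|c| * rootp p (fine (mu A)))%:E.
Proof.
move=> mA p1 A0 Aoo.
have normE x : (`|c * \1_A x| = `|c| * \1_A x)%R.
  by rewrite normrM [X in (_ * X)%R]ger0_norm.
have mA_fin : mu A \is a fin_num by rewrite ge0_fin_numE.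
rewrite unlock; case: p p1 => [q q1|_|//].
  have q0 : (0 < q)%R by move: q1; rewrite lee_fin; apply: lt_le_trans.
  under eq_integral => x _.
    rewrite /= normE powRM //.
    rewrite (_ : (\1_A x `^ q = \1_A x)%R); last first.
      by rewrite indicE; case: (_ \in _); rewrite ?powR1 // powR0 ?gt_eqF.
    over.
  under eq_integral do rewrite EFinM.
  rewrite integralZl //; last first.
    apply/integrableP; split; first exact/measurable_EFinP.
    under eq_integral do rewrite gee0_abs ?lee_fin //.
    by rewrite integral_indic // setIT.
  rewrite integral_indic // setIT poweRM //.
  rewrite poweR_EFin -powRrM mulfV ?gt_eqF // powRr1 // -[mu A]fineK //.
have T0 : 0 < mu setT by apply: lt_le_trans A0 _; apply: le_measure; rewrite ?inE.
rewrite T0 /= fine_gt0 ?A0 ?Aoo // mulr1; apply/eqP; rewrite eq_le; apply/andP; split.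
  apply/ess_supP; apply: nearW => x /=.
  by rewrite normE lee_fin indicE; case: (_ \in _); rewrite ?mulr1 ?mulr0.
rewrite leNgt; apply/negP => lt_c.
have := ess_sup_ge mu (abse \o (EFin \o (fun x => c * \1_A x)%R)).
move=> [B [mB B0 AB]].
suff AsubB : A `<=` B.
  have : mu A <= mu B by apply: le_measure => //; rewrite inE.
  by rewrite B0 leNgt A0.
move=> x Ax; apply: AB => /=; rewrite normE indicE mem_set // mulr1 => /(lt_le_trans lt_c).
by rewrite ltxx.
Qed.

(** Holder's inequality against the indicator of A, whose norm in the conjugate
    space is at most 1. *)
Lemma Lnorm1_le p A f : measurable_fun setT f -> measurable A -> 1 <= p ->
  0 < mu A -> mu A <= 1 -> (forall x, ~ A x -> f x = 0%R) ->
  'N[mu]_1[EFin \o f] <= 'N[mu]_p[EFin \o f].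
Proof.
move=> mf mA p1 A0 A1 fA.
have fE : f = (f \* \1_A)%R.
  apply/funext => x /=; rewrite indicE; have [Ax|Ax] := pselect (A x).
    by rewrite mem_set // mulr1.
  by rewrite memNset // mulr0 fA.
case: p p1 => [q q1|_|//].
  move: q1; rewrite lee_fin le_eqVlt => /predU1P[<- //|q1].
  have q0 : (0 < q)%R by exact: lt_trans q1.
  have q'0 : (0 < 1 - q^-1)%R by rewrite subr_gt0 invf_lt1.
  rewrite {1}fE; apply: (le_trans (@hoelder _ _ _ mu f \1_A q (1 - q^-1)^-1
    mf _ _ _ _)) => //.
  - by rewrite invr_gt0.
  - by rewrite invrK addrC subrK.
  rewrite -[leRHS]mule1; apply: lee_wpmul2l; first exact: Lnorm_ge0.
  have q'1 : 1 <= ((1 - q^-1)^-1)%:E :> \bar R.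
    by rewrite lee_fin invf_ge1 // gerBl invr_ge0 ltW.
  rewrite (@eq_Lnorm _ _ _ mu _ _ (EFin \o (fun x => 1 * \1_A x)%R)); last first.
    by move=> x /=; rewrite mul1r.
  rewrite Lnorm_cst_indic // ?(le_lt_trans A1) ?ltry // normr1 mul1r lee_fin.
  rewrite -[leRHS](rootp1 ((1 - q^-1)^-1)%:E); apply: le_rootp => //.
  by rewrite -lee_fin fineK // ge0_fin_numE ?ltW // (le_lt_trans A1) ?ltry.
have T0 : 0 < mu setT by apply: lt_le_trans A0 _; apply: le_measure; rewrite ?inE.
rewrite Lnorm1 unlock T0; set s := ess_sup _ _.
have s0 : 0 <= s by apply: ess_sup_gee => //; apply: nearW => x /=.
have -> : \int[mu]_x `|(EFin \o f) x| = \int[mu]_(x in A) `|(f x)%:E|.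
  rewrite [RHS]integral_mkcond; apply: eq_integral => x _.
  rewrite patchE /=; case: ifPn => //; rewrite notin_setE => /fA ->.
  by rewrite normr0.
apply: (@le_trans _ _ (\int[mu]_(x in A) cst s x)); last first.
  by rewrite integral_cst // -[leRHS]mule1; apply: lee_wpmul2l.
apply: ae_ge0_le_integral => //.
  apply: measurable_funTS; apply: measurableT_comp => //; exact/measurable_EFinP.
have := ess_sup_ge mu (abse \o (EFin \o f)).
by apply: filterS => x /= + _.
Qed.
End Lnorm.

Section AmalgamOnH.
Variable R : realType.
Local Notation haar := (haar R).
Local Notation toC := (real_complex R).
Local Notation "\1t_ N" := (\1_(tailH N) : H -> R) (at level 2, N at level 1).

(** * Haar measure *)

Lemma nneseries_pow2 (m : nat) :
  (\sum_(m <= k <oo) ((2 : R) ^ (- k%:Z))%:E = ((2 : R) ^ (1 - m%:Z))%:E)%E.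
Proof.
rewrite -nneseries_addn; last by move=> i; rewrite lee_fin exprz_ge0.
have := @cvg_geometric_eseries_half R (2 ^ (1 - m%:Z)) 0.
rewrite expr0 divr1 => /cvg_lim <- //.
apply: eq_eseriesr => k _; congr EFin.
rewrite addn1 natrX [_ ^+ _]exprnP invr_expz -expfzDr //; congr (_ ^ _); lia.
Qed.

Lemma haarE (A : set H) : haar A =
  (\sum_(0 <= k <oo) ((2 : R) ^ (- (k%:Z + 1)) * \1_A (Some k%:Z))%:E
   + \sum_(0 <= k <oo) ((2 : R) ^ k%:Z * \1_A (Some (- (k%:Z + 1))))%:E)%E.
Proof. exact: measure_addE. Qed.

Lemma nneseries_single (f : nat -> R) (m : nat) : (forall k, 0 <= f k) ->
  (forall k, k != m -> f k = 0) ->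
  (\sum_(0 <= k <oo) (f k)%:E = (f m)%:E)%E.
Proof.
move=> f0 fm.
rewrite (nneseries_split 0%N m.+1); last by move=> k _; rewrite lee_fin.
rewrite add0n eseries0 ?adde0; last by move=> k mk _; rewrite fm // gt_eqF.
rewrite big_nat_recr //= big_nat big1 ?add0e // => k /andP[_ km].
by rewrite fm // lt_eqF.
Qed.

Lemma haar_point (n : int) : haar [set Some n] = ((2 : R) ^ (- (n + 1)))%:E.
Proof.
have p0 (z : int) (b : R) : 0 <= b -> 0 <= (2 : R) ^ z * b.
  by move=> b0; rewrite mulr_ge0 ?exprz_ge0.
have i0 x : 0 <= \1_[set Some n] x :> R by rewrite indicE.
have iE (m : int) : \1_[set Some n] (Some m : H) = (m == n)%:R :> R.
  rewrite indicE; congr (nat_of_bool _)%:R.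
  by apply/idP/eqP => [/set_mem [//]|->]; exact/mem_set.
rewrite haarE; have [n0|n0] := leP 0 n.
  rewrite (nneseries_single (m := `|n|)) => [|k|k kn]; last 2 first.
  - exact: p0.
  - by rewrite iE (_ : _ == _ = false) ?mulr0 //; apply/eqP => ?; lia.
  rewrite eseries0 ?adde0 => [|k _ _]; last first.
    by rewrite iE (_ : _ == _ = false) ?mulr0 //; apply/eqP => ?; lia.
  by rewrite iE gez0_abs // eqxx mulr1.
rewrite eseries0 ?add0e => [|k _ _]; last first.
  by rewrite iE (_ : _ == _ = false) ?mulr0 //; apply/eqP => ?; lia.
rewrite (nneseries_single (m := `|- (n + 1)|)) => [|k|k kn]; last 2 first.
- exact: p0.
- by rewrite iE (_ : _ == _ = false) ?mulr0 //; apply/eqP => ?; lia.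
have nE : `|- (n + 1)|%:Z = - (n + 1) by lia.
by rewrite iE nE (_ : _ == n) ?mulr1 //; apply/eqP; lia.
Qed.

Lemma haar_tail0 : haar (tailH 0) = 1%E.
Proof.
rewrite haarE [X in (_ + X)%E]eseries0 ?adde0; last first.
  by move=> k _ _; rewrite indicE memNset ?mulr0 //= => ?; lia.
under eq_eseriesr => k _.
  rewrite indicE mem_set //= mulr1.
  rewrite (_ : k%:Z + 1 = (k + 1)%N%:Z); last by lia.
  over.
rewrite (@nneseries_addn _ (fun k => ((2 : R) ^ (- k%:Z))%:E)) ?nneseries_pow2 //.
Qed.

Lemma tailH_split (N : int) : tailH N = Some N |` tailH (N + 1).
Proof.
apply/seteqP; split => [[n|] /=|[n|] //= []].
- rewrite le_eqVlt => /predU1P[->|Nn]; [by left|by right; lia].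
- by right.
- by case=> ->.
- by move=> ?; lia.
Qed.

Lemma haar_tail_step (N : int) :
  haar (tailH N) = (((2 : R) ^ (- (N + 1)))%:E + haar (tailH (N + 1)))%E.
Proof.
rewrite tailH_split measureU //; first by congr (_ + _)%E; exact: haar_point.
by apply/seteqP; split => // x [/= -> /=]; rewrite gerDl.
Qed.

Lemma haar_tail (N : int) : haar (tailH N) = ((2 : R) ^ (- N))%:E.
Proof.
have two (n : int) : (2 : R) ^ (- n) = 2 ^ (- (n + 1)) + 2 ^ (- (n + 1)).
  rewrite [in LHS](_ : - n = - (n + 1) + 1); last by lia.
  by rewrite expfzDr ?pnatr_eq0 // expr1z mulr_natr mulr2n.
elim/int_ind: N => [|k IH|k IH].
- by rewrite haar_tail0.
- move: IH; rewrite haar_tail_step (two k) (_ : k%:Z + 1 = k.+1%:Z); last by lia.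
  case: (haar _) => // r; rewrite -EFinD => -[/eqP].
  by rewrite (inj_eq (addrI _)) => /eqP ->.
- rewrite haar_tail_step (two (- k.+1%:Z)) EFinD (_ : - k.+1%:Z + 1 = - k%:Z) ?IH //.
  by lia.
Qed.

(** * Translates of tails, and characters *)

Lemma Rintegral_indic (mu : {measure set H -> \bar R}) (A : set H) :
  \int[mu]_x \1_A x = fine (mu A).
Proof. by rewrite /Rintegral integral_indic // setIT. Qed.

Lemma indic_tailH (N n : int) : \1t_N (Some n) = (N <= n)%R%:R :> R.
Proof.
rewrite indicE; congr (nat_of_bool _)%:R.
by apply/idP/idP => [/set_mem|?] //; exact/mem_set.
Qed.

Lemma indic_tailH_infty (N : int) : \1t_N None = 1 :> R.
Proof. by rewrite indicE mem_set. Qed.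

Lemma translR_neq (x y : H) (g : H -> R) : x != y ->
  translR x g y = g (minH x y).
Proof.
move=> /negbTE xy; rewrite /translR /conv_mass xy /Rintegral.
by rewrite integral_dirac // diracT mul1e.
Qed.

Lemma translR_infty (g : H -> R) : translR None g None = g None.
Proof.
rewrite /translR /conv_mass eqxx /Rintegral.
by rewrite integral_dirac // diracT mul1e.
Qed.

(** The mass is the sum of 2^-k over k >= max(1, N - n), and the whole of it is
    1. *)
Lemma conv_mass_diag (n N : int) :
  conv_mass R (Some n) (Some n) (tailH N) = ((2 : R) ^ (Num.min 0 (n - N + 1)))%:E.
Proof.
rewrite /conv_mass eqxx.
transitivity (\sum_(1 <= k <oo) ((2 : R) ^ (- k%:Z) * \1t_N (Some (n + k%:Z)))%:E)%E.
  by [].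
(* The first m terms, those with n + k < N, vanish. *)
pose m := absz (Num.max 0 (N - n - 1)).
rewrite (nneseries_split 1%N m); last first.
  by move=> k _; rewrite lee_fin mulr_ge0 ?exprz_ge0.
rewrite big_nat big1 ?add0e => [|k /andP[k1 km]]; last first.
  by rewrite indic_tailH (_ : _ <= _ = false) ?mulr0 //; apply/negP => ?; rewrite /m in km; lia.
transitivity (\sum_((1 + m)%N <= k <oo) ((2 : R) ^ (- k%:Z))%:E)%E; last first.
  rewrite nneseries_pow2; congr (_ ^ _)%:E; rewrite /m; lia.
rewrite [LHS]eseries_cond [RHS]eseries_cond.
apply: eq_eseriesr => k /=; rewrite indic_tailH => mk.
by rewrite (_ : _ <= _ = true) ?mulr1 //; apply/idP; rewrite /m in mk; lia.
Qed.

Lemma translR_tail_diag (n N : int) :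
  translR (Some n) \1t_N (Some n) = 2 ^ (Num.min 0 (n - N + 1)).
Proof. by rewrite /translR Rintegral_indic conv_mass_diag. Qed.

Lemma translR_tail_in (x y : H) (N : int) : tailH N x ->
  translR x \1t_N y = \1t_N y.
Proof.
have [<-|xy] := eqVneq x y; last rewrite translR_neq //.
  case: x => [n|] /= Nx; last exact: translR_infty.
  rewrite translR_tail_diag indic_tailH Nx (_ : Num.min _ _ = 0) //; lia.
case: x y xy => [n|] [k|] //= _ Nn; rewrite ?indic_tailH ?indic_tailH_infty ?Nn //.
by congr (nat_of_bool _)%:R; lia.
Qed.

Lemma translR_tail_out (n : int) (y : H) (N : int) : n < N ->
  translR (Some n) \1t_N y = 2 ^ (n - N + 1) * \1_[set Some n] y.
Proof.
move=> nN; rewrite indicE.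
have [<-|xy] := eqVneq (Some n) y.
  rewrite translR_tail_diag mem_set // mulr1; congr (_ ^ _); lia.
rewrite memNset ?mulr0 => [|yn]; last by rewrite yn eqxx in xy.
rewrite translR_neq //; case: y xy => [k|] /= _; rewrite indic_tailH.
  by rewrite (_ : _ <= _ = false) //; lia.
by rewrite leNgt nN.
Qed.

(** The character of H that is 1 on U_N, -1 at N - 1 and 0 below, written in
    terms of tails because those are the sets on which the convolution and F
    are known. *)
Definition charH (N : int) (x : H) : R := 2 * \1t_N x - \1t_(N - 1) x.


Lemma charH_in (N : int) (x : H) : tailH N x -> charH N x = 1.
Proof.
rewrite /charH; case: x => [n|] /=; last by rewrite !indic_tailH_infty; lra.
move=> Nn; rewrite !indic_tailH Nn (_ : _ <= n = true); last by lia.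
by rewrite /=; lra.
Qed.

Lemma tailH_predP (N : int) (z : H) :
  ~ tailH N z -> z = Some (N - 1) \/ ~ tailH (N - 1) z.
Proof.
case: z => [n|] //= Nn; have [->|?] := eqVneq n (N - 1); [by left|right; lia].
Qed.

Lemma charH_pred (N : int) : charH N (Some (N - 1)) = -1.
Proof.
rewrite /charH !indic_tailH lexx (_ : _ <= _ = false) ?mulr0 ?sub0r //; lia.
Qed.

Lemma charH_out (N : int) (x : H) : ~ tailH (N - 1) x -> charH N x = 0.
Proof.
rewrite /charH; case: x => [n|] //= Nn; rewrite !indic_tailH.
rewrite (_ : N <= n = false); last by lia.
by rewrite (_ : N - 1 <= n = false) ?mulr0 ?subr0 //; lia.
Qed.

Lemma translR_charH_diag (n N : int) :
  translR (Some n) (charH N) (Some n) =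
  2 * translR (Some n) \1t_N (Some n) - translR (Some n) \1t_(N - 1) (Some n).
Proof.
have intI M : (conv_mass R (Some n) (Some n)).-integrable setT
    (EFin \o (\1t_M : H -> R)).
  apply/integrableP; split => //.
  under eq_integral => x _ do rewrite /= ger0_norm //.
  by rewrite integral_indic // setIT conv_mass_diag ltry.
rewrite {1}/translR RintegralB //; last first.
  exact: (integrableZl (@measurableT _ H) (2 : R) (intI N)).
by rewrite RintegralZl.
Qed.

Lemma charHM_lt (N m n : int) : m < n ->
  charH N (Some m) * charH N (Some n) = charH N (Some m).
Proof.
move=> lt_mn; have [Nm|/tailH_predP[[mN]|Nm]] := pselect (tailH N (Some m)).
- by rewrite !charH_in ?mulr1 //=; apply: le_trans Nm (ltW lt_mn).
- by rewrite [charH N (Some n)]charH_in ?mulr1 //= -ltzD1 -ltrBlDr -mN.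
- by rewrite (charH_out Nm) mul0r.
Qed.

(** Multiplicativity of the character.  Off the diagonal the convolution is a
    minimum; on the diagonal below N - 1 the two terms
    2 * 2^(n - N + 1) and 2^(n - (N - 1) + 1) cancel. *)
Lemma translR_charH (N : int) (x y : H) :
  translR x (charH N) y = charH N x * charH N y.
Proof.
have [<-|xy] := eqVneq x y.
  case: x => [n|]; last by rewrite translR_infty charH_in // mulr1.
  rewrite translR_charH_diag !translR_tail_diag.
  have [Nn|nN] := leP (N - 1) n.
    rewrite (_ : Num.min _ _ = 0); last by lia.
    rewrite (_ : Num.min _ _ = 0); last by lia.
    rewrite expr0z; have [/charH_in ->|/tailH_predP[->|//]] := pselect (tailH N (Some n)).
      by lra.
    by rewrite charH_pred; lra.
  rewrite charH_out /= ?mul0r; last by lia.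
  rewrite (_ : Num.min 0 (n - N + 1) = n - N + 1); last by lia.
  rewrite (_ : Num.min _ _ = n - N + 1 + 1); last by lia.
  by rewrite [in X in _ - X]expfzDr ?pnatr_eq0 // expr1z mulrC subrr.
rewrite translR_neq //; case: x y xy => [m|] [n|] // mn; rewrite /minH.
- have [lt_mn|lt_nm|E] := ltgtP m n; last by rewrite E eqxx in mn.
    by rewrite charHM_lt.
  by rewrite mulrC charHM_lt.
- by rewrite [charH N None]charH_in ?mulr1.
- by rewrite [charH N None]charH_in ?mul1r.
Qed.

(** * Functions of positive type *)

Lemma normc_real (a : R) : normc (toC a) = `|a|.
Proof. by rewrite /normc /= expr0n addr0 sqrtr_sqr. Qed.

Lemma normc_ge0 (z : R[i]) : 0 <= normc z.
Proof. by case: z => a b; exact: sqrtr_ge0. Qed.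

Lemma Re_le_normc (z : R[i]) : `|complex.Re z| <= normc z.
Proof. by case: z => a b /=; rewrite -sqrtr_sqr ler_wsqrtr // lerDl sqr_ge0. Qed.

Lemma Im_le_normc (z : R[i]) : `|complex.Im z| <= normc z.
Proof. by case: z => a b /=; rewrite -sqrtr_sqr ler_wsqrtr // lerDr sqr_ge0. Qed.

Lemma Rintegral0 (mu : {measure set H -> \bar R}) : \int[mu]_x (0 : R) = 0.
Proof. by rewrite /Rintegral integral0. Qed.

Lemma transl_real (x y : H) (g : H -> R) :
  transl x (toC \o g) y = toC (translR x g y).
Proof. by rewrite /transl /Cintegral /= Rintegral0. Qed.

Lemma loc_integrable_tail (f : H -> R[i]) (u : H -> R) (M : int) :
  loc_integrable f -> (forall x, `|u x| <= normc (f x) * \1t_M x) ->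
  haar.-integrable setT (EFin \o u).
Proof.
move=> /(_ _ (@compact_tailH M)) foo uf; apply/integrableP; split => //.
apply: le_lt_trans foo; rewrite [leRHS]integral_mkcond /=.
apply: ge0_le_integral => // x _; have := uf x.
by rewrite patchE indicE; case: ifP => _; rewrite ?mulr1 ?mulr0 lee_fin.
Qed.

Lemma bounded_tail_integrable (u : H -> R) (M : int) :
  (forall x, `|u x| <= \1t_M x) -> haar.-integrable setT (EFin \o u).
Proof.
move=> uM; apply/integrableP; split => //.
apply: (@le_lt_trans _ _ (\int[haar]_x (\1t_M x)%:E)%E).
  by apply: ge0_le_integral => // x _; rewrite lee_fin.
by rewrite integral_indic // setIT haar_tail ltry.
Qed.

(** The identity on translates gives g * g = c g, where c, the integral of g^2,
    is positive because g is 1 on a tail.  Positive type then says that the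
    integral of f (c g) is real and nonnegative, and c can be divided out. *)
Lemma positive_type_test (f : H -> R[i]) (g : H -> R) (M N : int) :
  positive_type f ->
  (forall x, tailH N x -> g x = 1) ->
  (forall x, `|g x| <= \1t_M x) ->
  (forall x y, translR x g y * g y = g x * g y ^+ 2) ->
  0 <= \int[haar]_x (complex.Re (f x) * g x) /\
  \int[haar]_x (complex.Im (f x) * g x) = 0.
Proof.
move=> [floc fpos] gN gM gg.
have supp x : g x != 0 -> tailH M x.
  move=> gx; apply: contrapT => Mx; move: (gM x).
  by rewrite indicE memNset // normr_le0 (negbTE gx).
have g1 x : `|g x| <= 1 by apply: le_trans (gM x) _; rewrite indicE; case: (_ \in _).
have ccG : Cc (toC \o g).
  split; first by apply: (@continuous_eventually_cst _ _ N) => x Nx; rewrite /= !gN.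
  rewrite -precompactE; apply: precompact_subset (_ : precompact (tailH M)); last first.
    by rewrite precompact_closed //; [exact: compact_tailH | exact: closed_tailH].
  by move=> x /= gx; apply: supp; apply: contra gx => /eqP ->.
pose c := \int[haar]_x (g x ^+ 2).
have intg : haar.-integrable setT (EFin \o (fun x => g x ^+ 2)).
  apply: (@bounded_tail_integrable _ M) => x.
  by rewrite normrX; apply: le_trans (gM x); rewrite expr2 ler_piMr.
have c0 : 0 < c.
  apply: (@lt_le_trans _ _ (\int[haar]_x \1t_N x)).
    by rewrite Rintegral_indic haar_tail /= exprz_gt0.
  apply: le_Rintegral => //.
    by apply: (@bounded_tail_integrable _ N) => x; rewrite ger0_norm.
  move=> x _; rewrite indicE; case: (boolP (x \in _)) => [/set_mem/gN -> |_].
    by rewrite expr1n.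
  by rewrite sqr_ge0.
have convE x : convol (toC \o g) (fun y => conjc ((toC \o g) y)) x = toC (g x * c).
  rewrite /convol /Cintegral; congr Complex.
    rewrite -RintegralZl //; apply: eq_Rintegral => y _.
    by rewrite transl_real /= oppr0 mulr0 subr0 gg.
  rewrite -[RHS](Rintegral0 haar); apply: eq_Rintegral => y _.
  by rewrite transl_real /= oppr0 mulr0 mul0r addr0.
have intf (h : R[i] -> R) : (forall z, `|h z| <= normc z) ->
    haar.-integrable setT (EFin \o (fun x => h (f x) * g x)).
  move=> hz; apply: (loc_integrable_tail (M := M) floc) => x.
  by rewrite normrM ler_pM.
have := fpos _ ccG; rewrite /Cintegral lecE /= => /andP[/eqP im re].
split.
  rewrite -(pmulr_rge0 _ c0) -RintegralZl //; last exact: intf Re_le_normc.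
  apply: le_trans re _; rewrite le_eqVlt; apply/orP; left; apply/eqP.
  apply: eq_Rintegral => x _; rewrite convE /=; case: (f x) => a b /=; ring.
apply: (mulfI (lt0r_neq0 c0)); rewrite mulr0 -[RHS]im.
rewrite -RintegralZl //; last exact: intf Im_le_normc.
apply: eq_Rintegral => x _; rewrite convE /=; case: (f x) => a b /=; ring.
Qed.

Section TailIntegrals.
Variable f : H -> R[i].
Hypothesis fpt : positive_type f.

(** For [h] the real or the imaginary part of a complex number. *)
Definition tail_int (h : R[i] -> R) (N : int) : R :=
  \int[haar]_x (h (f x) * \1t_N x).

Lemma tail_int_integrable (h : R[i] -> R) (N : int) :
  (forall z, `|h z| <= normc z) ->
  haar.-integrable setT (EFin \o (fun x => h (f x) * \1t_N x)).
Proof.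
move=> hz; apply: (loc_integrable_tail (M := N) fpt.1) => x.
by rewrite normrM ler_pM // ger0_norm.
Qed.

Lemma tail_int_step (h : R[i] -> R) (N : int) : (forall z, `|h z| <= normc z) ->
  tail_int h N = h (f (Some N)) * 2 ^ (- (N + 1)) + tail_int h (N + 1).
Proof.
move=> hz; have tE x : \1t_N x = \1_[set Some N] x + \1t_(N + 1) x.
  case: x => [n|]; last by rewrite !indic_tailH_infty indicE memNset ?add0r.
  rewrite !indic_tailH indicE; have [->|nN] := eqVneq n N.
    by rewrite mem_set // lexx (_ : _ <= N = false) ?addr0 //; lia.
  rewrite memNset ?add0r; last by case=> /eqP; apply/negP.
  by rewrite (_ : (N <= n) = (N + 1 <= n)) //; lia.
have intp : haar.-integrable setT
    (EFin \o (fun x : H => h (f (Some N)) * \1_[set Some N] x)).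
  apply: (loc_integrable_tail (M := N) fpt.1) => x.
  rewrite normrM [X in _ * X]ger0_norm // !indicE; case: (boolP (x \in [set Some N])).
    by move=> /set_mem ->; rewrite mem_set //= !mulr1.
  by move=> _; rewrite mulr0 mulr_ge0 // normc_ge0.
rewrite /tail_int.
transitivity (\int[haar]_x
   (h (f (Some N)) * \1_[set Some N] x + h (f x) * \1t_(N + 1) x)).
  apply: eq_Rintegral => x _; rewrite tE mulrDr; congr (_ + _).
  by rewrite indicE; case: (boolP (x \in _)) => [/set_mem ->//|_]; rewrite !mulr0.
rewrite RintegralD //; last exact: tail_int_integrable.
congr (_ + _).
transitivity (\int[haar]_(x in [set Some N]) h (f (Some N))).
  rewrite [RHS]Rintegral_mkcond; apply: eq_Rintegral => x _.
  by rewrite patchE indicE; case: ifP => _; rewrite ?mulr1 ?mulr0.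
by rewrite Rintegral_cst // haar_point.
Qed.

(** The test function is 1_(U_N): translating it by a point of U_N changes
    nothing, and translating it by n < N gives a function supported at n,
    outside U_N. *)
Lemma tail_int_pos (N : int) :
  0 <= tail_int (@complex.Re R) N /\ tail_int (@complex.Im R) N = 0.
Proof.
apply: (positive_type_test (M := N) (N := N) fpt) => [x Nx|x|x y].
- by rewrite indicE mem_set.
- by rewrite ger0_norm.
- have [Ny|Ny] := pselect (tailH N y); last first.
    by rewrite [\1t_N y]indicE memNset // expr0n !mulr0.
  have y1 : \1t_N y = 1 :> R by rewrite indicE mem_set.
  rewrite y1 expr1n !mulr1.
  have [Nx|Nx] := pselect (tailH N x).
    by rewrite translR_tail_in // y1 indicE mem_set.
  case: x Nx => [n|] //= Nn; rewrite translR_tail_out; last by rewrite ltNge; apply/negP.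
  rewrite !indicE !memNset ?mulr0 // => ny; apply: Nn; rewrite ny in Ny; exact: Ny.
Qed.

(** The test function is the character [charH N]. *)
Lemma tail_int_double (N : int) :
  tail_int (@complex.Re R) (N - 1) <= 2 * tail_int (@complex.Re R) N.
Proof.
have [+ _] : 0 <= \int[haar]_x (complex.Re (f x) * charH N x) /\
    \int[haar]_x (complex.Im (f x) * charH N x) = 0.
  apply: (positive_type_test (M := N - 1) (N := N) fpt) => [x|x|x y].
  - exact: charH_in.
  - rewrite indicE; have [Nx|Nx] := pselect (tailH (N - 1) x); last first.
      by rewrite memNset // charH_out // normr0.
    rewrite mem_set //; have [/charH_in ->|/tailH_predP[->|//]] := pselect (tailH N x).
      by rewrite normr1.
    by rewrite charH_pred normrN1.
  - by rewrite translR_charH expr2 mulrA.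
have cE x : complex.Re (f x) * charH N x =
    2 * (complex.Re (f x) * \1t_N x) - complex.Re (f x) * \1t_(N - 1) x.
  rewrite /charH; ring.
have intN M := tail_int_integrable M Re_le_normc.
under eq_Rintegral do rewrite cE.
rewrite RintegralB //; last exact: (integrableZl (@measurableT _ H) (2 : R) (intN N)).
by rewrite RintegralZl // subr_ge0.
Qed.

(** The imaginary parts of all tail integrals vanish, and f(n) is a multiple of
    the difference of two consecutive ones. *)
Lemma positive_type_real (n : int) : complex.Im (f (Some n)) = 0.
Proof.
have := tail_int_step n Im_le_normc.
rewrite !(tail_int_pos _).2 addr0 => /esym/eqP; rewrite mulf_eq0 => /orP[/eqP//|].
by rewrite expfz_eq0 pnatr_eq0 andbF.
Qed.

(** With F = F(n) and F' = F(n + 1), the value f(n) 2^-(n+1) is F - F', which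
    lies between -F' and F' because 0 <= F <= 2 F'. *)
Lemma positive_type_le_next (n : int) :
  normc (f (Some n)) <= 2 ^ (n + 1) * tail_int (@complex.Re R) (n + 1).
Proof.
have -> : normc (f (Some n)) = `|complex.Re (f (Some n))|.
  by have := positive_type_real n; case: (f _) => a b /= ->; rewrite expr0n addr0 sqrtr_sqr.
have := tail_int_step n Re_le_normc.
have [Fn _] := tail_int_pos n; have := tail_int_double (n + 1); rewrite addrK.
move: Fn; set F := tail_int _ n; set F' := tail_int _ _.
set a := complex.Re _ => Fn FF' FE.
rewrite mulrC -ler_pdivrMr ?exprz_gt0 // invr_expz.
rewrite -[X in _ * X]ger0_norm ?exprz_ge0 // -normrM ler_norml.
move: FE; set w := _ * _ => FE; lra.
Qed.

Lemma tail_int_mono (N : int) (k : nat) :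
  2 ^ (N - k%:Z) * tail_int (@complex.Re R) (N - k%:Z) <=
  2 ^ N * tail_int (@complex.Re R) N.
Proof.
elim: k => [|k IH]; first by rewrite subr0.
apply: le_trans IH; rewrite (_ : N - k.+1%:Z = N - k%:Z - 1); last by lia.
rewrite [X in _ <= X * _](_ : _ = 2 ^ (N - k%:Z - 1) * 2); last first.
  by rewrite -[X in _ * X]expr1z -expfzDr // subrK.
by rewrite -mulrA ler_pM2l ?exprz_gt0 // tail_int_double.
Qed.

Lemma positive_type_le (n N : int) : n < N ->
  normc (f (Some n)) <= 2 ^ N * tail_int (@complex.Re R) N.
Proof.
move=> nN; apply: le_trans (positive_type_le_next n) _.
have := tail_int_mono N (absz (N - (n + 1))%R).
by rewrite gez0_abs ?subKr //; lia.
Qed.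

End TailIntegrals.

(** * Amalgam norms *)

Implicit Types (f g : H -> R[i]) (U V : set H) (p : \bar R).

Lemma pow2_ge1 (z : int) : 0 <= z -> 1 <= (2 : R) ^ z.
Proof. by case: z => // k _; rewrite -exprnP exprn_ege1 ?ler1n. Qed.

Lemma normc_mul_indic f U x : normc (mul_indic f U x) = normc (f x) * \1_U x.
Proof. by rewrite /mul_indic normcM normc_real ger0_norm. Qed.

Lemma le_LpH p f g : (1 <= p)%E -> (forall x, normc (f x) <= normc (g x)) ->
  (LpH p f <= LpH p g)%E.
Proof.
move=> p1 fg; apply: (@le_Lnorm _ _ _ _ p (@normc R \o f) (@normc R \o g)) => // x.
by rewrite /= !ger0_norm ?normc_ge0 //; exact: fg.
Qed.

Lemma eq_LpH p f g : (forall x, normc (f x) = normc (g x)) -> LpH p f = LpH p g.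
Proof. by move=> fg; apply: eq_Lnorm => x /=; rewrite fg. Qed.

(** Integrating over a single point turns the Haar mass 2^-(n+1) into its p-th
    root. *)
Lemma LpH_point p f (c : R) (n : int) : (1 <= p)%E -> 0 <= c ->
  (forall x, normc (f x) = c * \1_[set Some n] x) ->
  LpH p f = (c * rootp p (2 ^ (- (n + 1))))%:E.
Proof.
move=> p1 c0 fc.
rewrite /LpH (@eq_Lnorm _ _ _ _ _ _ (EFin \o (fun x : H => c * \1_[set Some n] x)));
  last first.
  by move=> x /=; rewrite fc.
have hE := haar_point n.
rewrite Lnorm_cst_indic ?hE //; last 2 first.
- by rewrite lte_fin exprz_gt0.
- by rewrite ltry.
by rewrite ger0_norm.
Qed.

Lemma amalgamE p U f : (1 <= p)%E -> amalgam p U f =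
  ereal_sup [set LpH p (fun y => f y * toC (rootp p (translR x \1_U y)))
            | x in [set: H]].
Proof.
case: p => [q||] // _; congr (ereal_sup _); apply: eq_imagel => x _.
apply: eq_LpH => y; rewrite normc_mul_indic normcM normc_real ger0_norm //.
congr (_ * _); rewrite indicE /=; congr (nat_of_bool _)%:R.
by apply/idP/idP => [/set_mem //|?]; exact/mem_set.
Qed.

Lemma conv_mass_tail_fin (x y : H) (M : int) :
  conv_mass R x y (tailH M) \is a fin_num.
Proof.
have [<-|xy] := eqVneq x y.
  by case: x => [n|]; [rewrite conv_mass_diag | rewrite /conv_mass eqxx /= diracE].
by rewrite /conv_mass (negbTE xy) /= diracE.
Qed.

Lemma le_amalgam p U (M : int) f : (1 <= p)%E -> U `<=` tailH M ->
  (amalgam p U f <= amalgam p (tailH M) f)%E.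
Proof.
move=> p1 UM; rewrite !amalgamE //; apply: ub_ereal_sup => _ [x _ <-].
apply: le_trans (ereal_sup_ubound _); last by exists x.
apply: le_LpH => // y; rewrite !normcM !normc_real !ger0_norm ?rootp_ge0 //.
apply: ler_wpM2l; first exact: normc_ge0.
apply: le_rootp => //.
  by apply: Rintegral_ge0.
rewrite /translR !Rintegral_indic.
have leUM : (conv_mass R x y U <= conv_mass R x y (tailH M))%E.
  by apply: le_measure => //; rewrite inE.
apply: fine_le => //; last exact: conv_mass_tail_fin.
rewrite ge0_fin_numE // (le_lt_trans leUM) // -ge0_fin_numE //.
exact: conv_mass_tail_fin.
Qed.

(** The translate by n < M contributes the factor 2^(n - M + 1), the mass of
    {n} the factor 2^-(n + 1); their product 2^-M does not depend on n. *)
Lemma amalgam_tail p (M : int) f : (1 <= p)%E -> amalgam p (tailH M) f =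
  maxe (ereal_sup [set (normc (f (Some n)) * rootp p (2 ^ (- M)))%:E
                  | n in [set n : int | n < M]])
       (LpH p (mul_indic f (tailH M))).
Proof.
move=> p1; rewrite amalgamE //.
have inE x : tailH M x ->
    LpH p (fun y => f y * toC (rootp p (translR x \1t_M y))) =
    LpH p (mul_indic f (tailH M)).
  move=> Mx; apply: eq_LpH => y.
  rewrite translR_tail_in // normc_mul_indic normcM normc_real ger0_norm ?rootp_ge0 //.
  by congr (_ * _); rewrite indicE; case: (_ \in _); rewrite ?rootp1 ?rootp0.
have outE n : n < M ->
    LpH p (fun y => f y * toC (rootp p (translR (Some n) \1t_M y))) =
    (normc (f (Some n)) * rootp p (2 ^ (- M)))%:E.
  move=> nM.
  rewrite (LpH_point (n := n) (c := normc (f (Some n)) * rootp p (2 ^ (n - M + 1)))) //.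
  - rewrite -mulrA -rootpM ?exprz_ge0 // -expfzDr ?pnatr_eq0 //.
    by congr (_ * rootp _ (_ ^ _))%:E; lia.
  - by rewrite mulr_ge0 ?normc_ge0 ?rootp_ge0.
  move=> x; rewrite translR_tail_out // normcM normc_real ger0_norm ?rootp_ge0 //.
  rewrite rootpM ?exprz_ge0 // -mulrA indicE.
  by case: (boolP (x \in _)) => [/set_mem -> |_]; rewrite ?rootp1 ?rootp0 // !mulr0.
apply/eqP; rewrite eq_le; apply/andP; split.
  apply: ub_ereal_sup => _ [x _ <-]; rewrite le_max.
  have [Mx|] := pselect (tailH M x); first by rewrite inE // lexx orbT.
  case: x => [n|] //= nM; have {}nM : n < M by rewrite ltNge; apply/negP.
  by rewrite outE // ereal_sup_ubound //; exists n.
rewrite ge_max; apply/andP; split.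
  apply: ub_ereal_sup => _ [n nM <-]; rewrite -outE //.
  by apply: ereal_sup_ubound; exists (Some n).
by rewrite -(inE None) //; apply: ereal_sup_ubound; exists None.
Qed.

Section AmalgamPositiveType.
Variable f : H -> R[i].
Hypothesis fpt : positive_type f.
Variable p : \bar R.
Hypothesis p1 : (1 <= p)%E.

(** For N >= 0 the measure of U_N is at most 1, so the L^p norm dominates the
    L^1 norm there. *)
Lemma tail_int_le_LpH (N : int) : 0 <= N ->
  ((tail_int f (@complex.Re R) N)%:E <= LpH p (mul_indic f (tailH N)))%E.
Proof.
move=> N0; apply: (@le_trans _ _ (LpH 1 (mul_indic f (tailH N)))); last first.
  apply: (@Lnorm1_le _ _ _ _ p (tailH N) (@normc R \o mul_indic f (tailH N))) => //.
  - by rewrite haar_tail lte_fin exprz_gt0.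
  - by rewrite haar_tail lee_fin -invr_expz invf_le1 ?exprz_gt0 // pow2_ge1.
  - by move=> x Nx; rewrite /= normc_mul_indic indicE memNset // mulr0.
have intN := tail_int_integrable fpt N Re_le_normc.
rewrite /LpH Lnorm1 fineK; last exact: integrable_fin_num.
apply: le_trans (lee_abs _) _; apply: le_trans (le_abse_integral _ _ _) _ => //.
apply: ge0_le_integral => // x _; rewrite lee_fin [leRHS]ger0_norm ?normc_ge0 //.
by rewrite normc_mul_indic normrM [X in _ * X]ger0_norm // ler_wpM2r // Re_le_normc.
Qed.

(** Minkowski's inequality for the splitting of U_M into U_N and the finitely
    many points in between, where |f| is at most B = 2^N F(N). *)
Lemma LpH_tail_le (M N : int) : M <= 0 -> 0 <= N ->
  (LpH p (mul_indic f (tailH M)) <=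
   (1 + 2 ^ (N - M))%:E * LpH p (mul_indic f (tailH N)))%E.
Proof.
move=> M0 N0; set A := LpH p (mul_indic f (tailH N)).
pose B := 2 ^ N * tail_int f (@complex.Re R) N.
have B0 : 0 <= B by rewrite mulr_ge0 ?exprz_ge0 // (tail_int_pos fpt N).1.
pose u : H -> R := fun x => normc (f x) * \1t_N x.
pose v : H -> R := fun x => normc (f x) * (\1t_M x - \1t_N x).
have vB x : `|v x| <= `|B * \1t_M x|.
  case: x => [n|]; rewrite /v ?indic_tailH_infty ?subrr ?mulr0 ?normr0 //.
  rewrite !indic_tailH; have [nN|Nn] := ltP n N; last first.
    by rewrite (_ : M <= n) ?subrr ?mulr0 ?normr0 //; lia.
  rewrite subr0 normrM [leRHS]normrM ler_wpM2r // (ger0_norm B0) (ger0_norm (normc_ge0 _)).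
  exact: positive_type_le.
have -> : LpH p (mul_indic f (tailH M)) = 'N[haar]_p[EFin \o (u \+ v)%R]%E.
  apply: eq_Lnorm => x; rewrite /= normc_mul_indic /u /v; congr (_%:E); ring.
apply: le_trans (eminkowski _ _ _ _) _ => //.
rewrite EFinD ge0_muleDl ?mul1e ?lee_fin ?exprz_ge0 //.
apply: leeD.
  have -> // : A = 'N[haar]_p[EFin \o u]%E.
  by apply: eq_Lnorm => x; rewrite /= normc_mul_indic.
apply: (@le_trans _ _ 'N[haar]_p[EFin \o (fun x : H => B * \1t_M x)%R]%E).
  exact: le_Lnorm.
rewrite Lnorm_cst_indic //; last 2 first.
- by rewrite haar_tail lte_fin exprz_gt0.
- by rewrite haar_tail ltry.
rewrite haar_tail ger0_norm //.
apply: (@le_trans _ _ ((2 ^ (N - M))%:E * (tail_int f (@complex.Re R) N)%:E)%E).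
  rewrite lee_fin expfzDr ?pnatr_eq0 // [leRHS]mulrAC; apply: ler_wpM2l => //.
  by apply: rootp_le; rewrite //= pow2_ge1 // oppr_ge0.
by apply: lee_wpmul2l; rewrite ?lee_fin ?exprz_ge0 // tail_int_le_LpH.
Qed.

Lemma amalgam_tail_le (M N : int) : M <= 0 -> 0 <= N ->
  (amalgam p (tailH M) f <=
   (1 + 2 ^ (N - M))%:E * LpH p (mul_indic f (tailH N)))%E.
Proof.
move=> M0 N0; rewrite amalgam_tail // ge_max LpH_tail_le // andbT.
apply: ub_ereal_sup => _ [n /= nM <-].
apply: (@le_trans _ _ ((2 ^ (N - M))%:E * (tail_int f (@complex.Re R) N)%:E)%E).
  rewrite lee_fin expfzDr ?pnatr_eq0 // mulrAC ler_pM ?normc_ge0 ?rootp_ge0 //.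
    by apply: positive_type_le => //; lia.
  by rewrite rootp_le // pow2_ge1 // oppr_ge0.
apply: lee_pmul; rewrite ?lee_fin ?exprz_ge0 ?(tail_int_pos fpt N).1 ?lerDr //.
exact: tail_int_le_LpH.
Qed.

Lemma amalgam_tail0 : amalgam p (tailH 0) f = LpH p (mul_indic f (tailH 0)).
Proof.
rewrite amalgam_tail //; apply/max_idPr; apply: ub_ereal_sup => _ [n /= n0 <-].
rewrite oppr0 expr0z rootp1 mulr1; apply: le_trans (tail_int_le_LpH _) => //.
by rewrite lee_fin; have := positive_type_le fpt n0; rewrite expr0z mul1r.
Qed.

Lemma star_norm_amalgam : star_norm p f = amalgam p (tailH 0) f.
Proof.
rewrite amalgam_tail //; congr (maxe (ereal_sup _) _).
by apply: eq_imagel => n _; rewrite oppr0 expr0z rootp1 mulr1.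
Qed.
End AmalgamPositiveType.

End AmalgamOnH.

(** * The comparison of norms *)

Local Open Scope ereal_scope.
Theorem theorem32 (R : realType) :
  (forall (p : \bar R) (f : H -> R[i]), 1 <= p -> positive_type f ->
     star_norm p f = amalgam p (tailH 0) f /\
     amalgam p (tailH 0) f = LpH p (mul_indic f (tailH 0))) /\
  (forall U : set H, nbhs (None : H) U -> precompact U ->
     exists CU CU' : R, (0 < CU)%R /\ (0 < CU')%R /\
       forall (p : \bar R) (f : H -> R[i]), 1 <= p -> positive_type f ->
         amalgam p U f <= CU%:E * LpH p (mul_indic f U) /\
         star_norm p f <= CU'%:E * LpH p (mul_indic f U)).
Proof.
split=> [p f p1 fpt|U [N0 _ N0U]].
  by rewrite star_norm_amalgam // amalgam_tail0.
rewrite precompactE => /compact_sub_tailH[M0 UM0].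
pose N : int := Num.max N0 (0 : int)%R; pose M : int := Num.min M0 (0 : int)%R.
have NU : tailH N `<=` U.
  by apply: subset_trans N0U; apply: tailH_le; rewrite le_max lexx.
have UM : U `<=` tailH M.
  apply: subset_trans (@subset_closure _ U) _; apply: subset_trans UM0 _.
  by apply: tailH_le; rewrite ge_min lexx.
have M0' : (M <= 0)%R by rewrite ge_min lexx orbT.
have N0' : (0 <= N)%R by rewrite le_max lexx orbT.
pose C : R := (1 + 2 ^ (N - M))%R.
have C0 : (0 < C)%R by rewrite addr_gt0 ?exprz_gt0.
exists C, C; split=> //; split=> // p f p1 fpt.
have CA : amalgam p (tailH M) f <= C%:E * LpH p (mul_indic f U).
  apply: le_trans (amalgam_tail_le fpt p1 M0' N0') _.
  apply: lee_wpmul2l; first by rewrite lee_fin ltW.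
  apply: le_LpH => // x; rewrite !normc_mul_indic ler_wpM2l ?normc_ge0 //.
  rewrite !indicE ler_nat; case: (boolP (x \in tailH N)) => // /set_mem/NU Ux.
  by rewrite mem_set.
split; first by apply: le_trans CA; exact: le_amalgam.
rewrite star_norm_amalgam //; apply: le_trans CA; apply: le_amalgam => //.
exact: tailH_le.
Qed.
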